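(* Let $\mathcal{SB}$ denote the category of skew left braces. Then the association $\mathcal{O}:\mathcal{SB}\to\mathcal{SB}$ given by $\mathcal{O}\big((H,\cdot,\circ)\big)=(\widetilde H,\bullet,\odot)$, where $(\widetilde H,\bullet,\odot)$ is the square of $(H,\cdot,\circ)$, is a covariant functor.
   Context: A skew left brace is a triple $(H,\cdot,\circ)$ where $(H,\cdot)$ and $(H,\circ)$ are groups with $a\circ(b\cdot c)=(a\circ b)\cdot a^{-1}\cdot(a\circ c)$ for all $a,b,c\in H$, where $a^{-1}$ is the inverse in $(H,\cdot)$. The inverse of $g$ in $(H,\circ)$ is denoted $g^\dagger$. A homomorphism of skew left braces is a map preserving both operations. The associated action $\lambda^H:(H,\circ)\to\mathrm{Aut}(H,\cdot)$ is the homomorphism $\lambda^H_a(b)=a^{-1}\cdot(a\circ b)$. The square of $(H,\cdot,\circ)$ is the skew left brace $(\widetilde H,\bullet,\odot)$ on the set $\widetilde H=H\times H$ with $$(h_1,g_1)\bullet(h_2,g_2)=\big(h_1\cdot\lambda^H_{g_1}(h_2),\ g_1\circ g_2\big),\qquad (h_1,g_1)\odot(h_2,g_2)=\big(h_1\circ h_2,\ h_1\circ g_2\circ h_1^\dagger\circ g_1\big)$$ for all $g_1,g_2,h_1,h_2\in H$; its additive group is the semi-direct product $(H,\cdot)\rtimes_{\lambda^H}(H,\circ)$. *)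

(* Defs.v *)
From HB Require Import structures.
From mathcomp Require Import all_boot.
From mathcomp Require Import boolp.

Set Implicit Arguments.
Unset Strict Implicit.
Unset Printing Implicit Defensive.

Import Algebra.
Local Open Scope group_scope.

Reserved Notation "x \circ y" (at level 40, left associativity).

(* The additive group (H, .) is the groupType structure of H, written
   multiplicatively as in the literature on skew left braces. *)
HB.mixin Record Group_isSkewBrace H of Group H := {
  circ : H -> H -> H;
  circ1 : H;
  dag : H -> H;
  circA : associative circ;
  circ1x : left_id circ1 circ;
  circx1 : right_id circ1 circ;
  circVx : left_inverse circ1 dag circ;
  circxV : right_inverse circ1 dag circ;
  circM : forall a b c : H, circ a (b * c) = circ a b * a^-1 * circ a c
}.

#[short(type="skewBraceType")]
HB.structure Definition SkewBrace := {H of Group_isSkewBrace H & Group H}.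

Bind Scope group_scope with SkewBrace.sort.

Notation "x \circ y" := (circ x y) : group_scope.

(* The group (H, o), as a groupType on an alias of H. *)
Definition circ_group (H : skewBraceType) : Type := H.

HB.instance Definition _ (H : skewBraceType) := Choice.on (circ_group H).
HB.instance Definition _ (H : skewBraceType) :=
  isGroup.Build (circ_group H) (@circA H) (@circ1x H) (@circx1 H)
    (@circVx H) (@circxV H).

Definition lambda (H : skewBraceType) (a b : H) : H := a^-1 * (a \circ b).

HB.mixin Record isCircMultiplicative (H K : skewBraceType) (f : H -> K) := {
  circ_morphM : {morph f : x y / x \circ y}
}.

HB.structure Definition SkewBraceMorphism (H K : skewBraceType) :=
  {f of isMultiplicative H K f & isCircMultiplicative H K f}.

Notation sb_hom := SkewBraceMorphism.type.

Section LambdaTheory.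
Variable H : skewBraceType.
Implicit Types a b c : H.

Lemma circE a b : a \circ b = a * lambda a b.
Proof. by rewrite /lambda mulVKg. Qed.

Lemma circ_g1 a : a \circ 1 = a.
Proof.
apply: (mulIg (a^-1 * (a \circ 1))).
by rewrite mulgA -circM mulg1 mulVKg.
Qed.

Lemma circ1E : circ1 = 1 :> H.
Proof. by rewrite -[LHS]circ_g1 circ1x. Qed.

Lemma lambdaM a : {morph lambda a : b c / b * c}.
Proof. by move=> b c; rewrite /lambda circM !mulgA. Qed.

Lemma lambda_g1 a : lambda a 1 = 1.
Proof. by rewrite /lambda circ_g1 mulVg. Qed.

Lemma lambda_circ1 b : lambda circ1 b = b.
Proof. by rewrite /lambda circ1x circ1E invg1 mul1g. Qed.

Lemma lambdaV a b : lambda a b^-1 = (lambda a b)^-1.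
Proof. by apply/esym/mulg1_eq; rewrite -lambdaM mulgV lambda_g1. Qed.

Lemma lambda_circ a b c : lambda (a \circ b) c = lambda a (lambda b c).
Proof.
by apply: (mulgI (a \circ b)); rewrite -circE -circA (circE b) circM
  [in LHS]/lambda {1}/lambda !mulgA.
Qed.

Lemma circ_dagK a b : a \circ (dag a \circ b) = b.
Proof. by rewrite circA circxV circ1x. Qed.

Lemma dag_circK a b : dag a \circ (a \circ b) = b.
Proof. by rewrite circA circVx circ1x. Qed.

Lemma dagK a : dag (dag a) = a.
Proof. exact: (@invgK (circ_group H)). Qed.

Lemma dagM a b : dag (a \circ b) = dag b \circ dag a.
Proof. exact: (@invgM (circ_group H)). Qed.

End LambdaTheory.

(* An alias of H * H, which keeps the square apart from the componentwise
   product structure on pairs. *)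
Definition square_sort (H : skewBraceType) : Type := (H * H)%type.

HB.instance Definition _ (H : skewBraceType) := Choice.on (square_sort H).

Section Square.
Variable H : skewBraceType.
Implicit Types x y z : square_sort H.

Definition square_mul x y : square_sort H :=
  (x.1 * lambda x.2 y.1, x.2 \circ y.2).

Definition square_one : square_sort H := (1, circ1).

Definition square_inv x : square_sort H :=
  (lambda (dag x.2) x.1^-1, dag x.2).

Definition square_circ x y : square_sort H :=
  (x.1 \circ y.1, x.1 \circ y.2 \circ dag x.1 \circ x.2).

Definition square_circ1 : square_sort H := (circ1, circ1).

Definition square_dag x : square_sort H :=
  (dag x.1, dag x.1 \circ dag x.2 \circ x.1).

Lemma square_mulA : associative square_mul.
Proof.
by move=> x y z; rewrite /square_mul /= lambdaM lambda_circ mulgA circA.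
Qed.

Lemma square_mul1x : left_id square_one square_mul.
Proof. by case=> h g; rewrite /square_mul /= mul1g lambda_circ1 circ1x. Qed.

Lemma square_mulx1 : right_id square_one square_mul.
Proof. by case=> h g; rewrite /square_mul /= lambda_g1 mulg1 circx1. Qed.

Lemma square_mulVx : left_inverse square_one square_inv square_mul.
Proof.
by case=> h g; rewrite /square_mul /= -lambdaM mulVg lambda_g1 circVx.
Qed.

Lemma square_mulxV : right_inverse square_one square_inv square_mul.
Proof.
by case=> h g; rewrite /square_mul /= -lambda_circ circxV lambda_circ1 mulgV.
Qed.

HB.instance Definition _ :=
  isGroup.Build (square_sort H) square_mulA square_mul1x square_mulx1
    square_mulVx square_mulxV.

Lemma square_circA : associative square_circ.
Proof.
move=> x y z; rewrite /square_circ /= dagM circA; congr pair.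
by rewrite -!circA dag_circK.
Qed.

Lemma square_circ1x : left_id square_circ1 square_circ.
Proof.
have d1 : dag circ1 = circ1 :> H by rewrite -[LHS]circ1x circxV.
by case=> h g; rewrite /square_circ /= d1 !circ1x !circx1.
Qed.

Lemma square_circx1 : right_id square_circ1 square_circ.
Proof. by case=> h g; rewrite /square_circ /= !circx1 circxV circ1x. Qed.

Lemma square_circVx : left_inverse square_circ1 square_dag square_circ.
Proof.
case=> h g; rewrite /square_circ /= circVx dagK; congr pair.
by rewrite -!circA circ_dagK circ_dagK circVx.
Qed.

Lemma square_circxV : right_inverse square_circ1 square_dag square_circ.
Proof.
case=> h g; rewrite /square_circ /= circxV; congr pair.
by rewrite -!circA circ_dagK circ_dagK circVx.
Qed.

Lemma square_circM x y z :
  square_circ x (y * z) = square_circ x y * x^-1 * square_circ x z.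
Proof.
case: x y z => [h1 g1] [h2 g2] [h3 g3]; congr pair => /=; last first.
  by rewrite -!circA circ_dagK dag_circK.
rewrite circE lambdaM mulgA -circE -[RHS](mulgA (h1 \circ h2)); congr (_ * _).
rewrite -[in RHS]lambda_circ -[RHS]lambdaM -!circA circxV circx1 -/(lambda h1 h3).
by rewrite !lambda_circ -[lambda (dag h1) _]lambda_circ circVx lambda_circ1.
Qed.

HB.instance Definition _ :=
  Group_isSkewBrace.Build (square_sort H) square_circA square_circ1x
    square_circx1 square_circVx square_circxV square_circM.

End Square.

Definition square (H : skewBraceType) : skewBraceType := square_sort H.

Section SkewBraceMorphismTheory.
Variables H K L : skewBraceType.

Fact idfun_circ_morphM : {morph @idfun H : x y / x \circ y}.
Proof. by []. Qed.

HB.instance Definition _ :=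
  isCircMultiplicative.Build H H idfun idfun_circ_morphM.

Fact comp_circ_morphM (f : sb_hom K L) (g : sb_hom H K) :
  {morph f \o g : x y / x \circ y}.
Proof. by move=> x y /=; rewrite !circ_morphM. Qed.

HB.instance Definition _ (f : sb_hom K L) (g : sb_hom H K) :=
  isCircMultiplicative.Build H L (f \o g) (comp_circ_morphM f g).

Lemma sb_hom_eq (f g : sb_hom H K) : f =1 g -> f = g.
Proof.
case: f g => f [[fM] [fC]] [g [[gM] [gC]]] /= /funext fg; case: _ / fg gM gC.
by move=> gM gC; rewrite (Prop_irrelevance gM fM) (Prop_irrelevance gC fC).
Qed.

End SkewBraceMorphismTheory.

Definition sb_id (H : skewBraceType) : sb_hom H H := idfun.

Definition sb_comp (H K L : skewBraceType) (f : sb_hom K L) (g : sb_hom H K) :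
  sb_hom H L := f \o g.

Record category := Category {
  obj :> Type;
  hom : obj -> obj -> Type;
  idm : forall a : obj, hom a a;
  compm : forall a b c : obj, hom b c -> hom a b -> hom a c;
  comp1m : forall (a b : obj) (f : hom a b), compm (idm b) f = f;
  compm1 : forall (a b : obj) (f : hom a b), compm f (idm a) = f;
  compmA : forall (a b c d : obj) (f : hom c d) (g : hom b c) (h : hom a b),
    compm f (compm g h) = compm (compm f g) h
}.

Record is_functor (C D : category) (F0 : C -> D)
    (F1 : forall a b : C, hom a b -> hom (F0 a) (F0 b)) : Prop := IsFunctor {
  functor_id : forall a : C, F1 a a (idm a) = idm (F0 a);
  functor_comp : forall (a b c : C) (f : hom b c) (g : hom a b),
    F1 a c (compm f g) = compm (F1 b c f) (F1 a b g)
}.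

Fact sb_comp1m (H K : skewBraceType) (f : sb_hom H K) :
  sb_comp (sb_id K) f = f.
Proof. exact: sb_hom_eq. Qed.

Fact sb_compm1 (H K : skewBraceType) (f : sb_hom H K) :
  sb_comp f (sb_id H) = f.
Proof. exact: sb_hom_eq. Qed.

Fact sb_compmA (H K L M : skewBraceType)
    (f : sb_hom L M) (g : sb_hom K L) (h : sb_hom H K) :
  sb_comp f (sb_comp g h) = sb_comp (sb_comp f g) h.
Proof. exact: sb_hom_eq. Qed.

Definition SB : category :=
  @Category skewBraceType (fun H K => sb_hom H K) sb_id sb_comp
    sb_comp1m sb_compm1 sb_compmA.

(* Main.v *)
From HB Require Import structures.
Require Import Defs.
From mathcomp Require Import all_boot.

Import Algebra.
Local Open Scope group_scope.

(** The operations of the square of H are words in the product, the circle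
    operation, the action lambda and the circle inverse of H, evaluated on the
    coordinates.  A morphism of skew left braces commutes with the first two
    by definition, and therefore with the other two: with the circle inverse
    as any group homomorphism does ([circ_morphV]), and with lambda because
    lambda a b is the unique solution x of a * x = a \circ b
    ([circ_morph_lambda]).
    So applying f to both coordinates is a morphism between the squares, and
    functoriality is then pointwise, because identities and composites are
    computed coordinatewise and a morphism is determined by its underlying
    function. *)

Section MorphismTransport.
Variables (H K : skewBraceType) (f : sb_hom H K).

Lemma circ_morph1 : f circ1 = circ1.
Proof. by apply: (mulgI (f circ1)); rewrite -gmulfM !circ1E !mulg1. Qed.

(** As for any homomorphism of groups: the image of the inverse is a left
    inverse of the image. *)
Lemma circ_morphV a : f (dag a) = dag (f a).
Proof.
by rewrite -[LHS]circx1 -(circxV (f a)) circA -circ_morphM circVx circ_morph1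
  circ1x.
Qed.

Lemma circ_morph_lambda a b : f (lambda a b) = lambda (f a) (f b).
Proof.
by apply: (mulgI (f a)); rewrite -gmulfM -!circE; exact: circ_morphM.
Qed.

Definition square_map (x : square H) : square K := (f x.1, f x.2).

Lemma square_map_mul : {morph square_map : x y / x * y}.
Proof.
move=> x y; congr pair => /=; last exact: circ_morphM.
by rewrite -circ_morph_lambda; exact: gmulfM.
Qed.

Lemma square_map_circ : {morph square_map : x y / x \circ y}.
Proof.
by move=> x y; congr pair => /=; rewrite !circ_morphM ?circ_morphV.
Qed.

HB.instance Definition _ :=
  isMultiplicative.Build (square H) (square K) square_map square_map_mul.
HB.instance Definition _ :=
  isCircMultiplicative.Build (square H) (square K) square_map square_map_circ.

Definition square_hom : sb_hom (square H) (square K) := square_map.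

End MorphismTransport.

Theorem proposition4p8 :
  exists O1 : forall H K : skewBraceType,
      sb_hom H K -> sb_hom (square H) (square K),
    (forall (H K : skewBraceType) (f : sb_hom H K) (h g : H),
       O1 H K f (h, g) = (f h, f g)) /\
    @is_functor SB SB square O1.
Proof.
exists square_hom; split=> [//|]; split=> [H|H K L f g].
  by apply: sb_hom_eq => -[].
exact: sb_hom_eq.
Qed.
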